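(* Let $n\ge 3$ be an integer and let $C\subset \mathbb{P}^2(\mathbb{C})$ and $D\subset \mathbb{P}^2(\mathbb{C})$ be two smooth conics such that there exists one $n$-gon inscribed in $D$ and circumscribed around $C$. Then there are infinitely many $n$-gons that are inscribed in $D$ and circumscribed around $C$.
   Context: The ground field is $\mathbb{C}$ and $\mathbb{P}^2=\mathbb{P}^2(\mathbb{C})$ is the complex projective plane. An $n$-gon is a set of $n$ vertices connected by $n$ distinct lines (its sides): that is, it is given by $n$ distinct points $p_1,\dots,p_n\in\mathbb{P}^2$ (the vertices) and $n$ distinct lines $l_1,\dots,l_n\subset\mathbb{P}^2$ (the sides) such that, with indices taken modulo $n$, $l_i$ is the line through $p_i$ and $p_{i+1}$. An $n$-gon is inscribed in a given curve if this curve passes through its $n$ vertices. An $n$-gon is circumscribed around a smooth conic $C$ if its sides, i.e. the $n$ lines, are tangent to $C$. *)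

(* Defs.v *)
From mathcomp Require Import all_boot all_order all_algebra.
From mathcomp Require Import classical_sets functions cardinality reals.
From mathcomp Require Import complex mpoly.
Set Implicit Arguments.
Unset Strict Implicit.
Unset Printing Implicit Defensive.
Import GRing.Theory.
Local Open Scope ring_scope.
Local Open Scope classical_set_scope.

(* The projective plane P^2(F): its points and lines are the subspaces of F^3
   of (vector space) dimension 1 and 2. *)
Definition point (F : fieldType) := {p : {vspace 'rV[F]_3} | \dim p == 1%N}.
Definition line (F : fieldType) := {l : {vspace 'rV[F]_3} | \dim l == 2%N}.

Definition on_line (F : fieldType) (p : point F) (l : line F) : bool :=
  (val p <= val l)%VS.

(* Meaningful for homogeneous [f] of positive degree (forms of degree 1 and 2
   below): the condition at the zero vector is then void, and the condition at
   any one nonzero vector of [p] implies it at the others. *)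
Definition vanishes_at (F : fieldType) (f : {mpoly F[3]}) (p : point F) : Prop :=
  forall v : 'rV[F]_3, v \in val p -> f.@[v ord0] = 0.

(* Plane curves are represented by their equations. *)
Definition conic (F : fieldType) (f : {mpoly F[3]}) : Prop :=
  f != 0 /\ f \is 2.-homog.

Definition singular_at (F : fieldType) (f : {mpoly F[3]}) (p : point F) : Prop :=
  vanishes_at f p /\ forall i : 'I_3, vanishes_at f^`M(i) p.

(* Only F-points are tested: this is smoothness for algebraically closed F. *)
Definition smooth_conic (F : fieldType) (f : {mpoly F[3]}) : Prop :=
  conic f /\ forall p : point F, ~ singular_at f p.

(* At a smooth point [p] of the curve [f = 0], the only such [l] is the
   projective tangent line { w | \sum_i (df/dX_i)(p) w_i = 0 }. *)
Definition tangent_line_at (F : fieldType) (f : {mpoly F[3]}) (p : point F)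
    (l : line F) : Prop :=
  forall v w : 'rV[F]_3, v \in val p -> w \in val l ->
    \sum_(i < 3) f^`M(i).@[v ord0] * w ord0 i = 0.

Definition tangent (F : fieldType) (f : {mpoly F[3]}) (l : line F) : Prop :=
  exists p : point F, [/\ vanishes_at f p, on_line p l & tangent_line_at f p l].

(* A polygon is the pair (set of vertices, set of sides), so that relabelling
   the vertices does not give a new polygon. *)
Definition polygon (F : fieldType) : Type := (set (point F) * set (line F))%type.

(* [ordS i] is [i + 1] modulo [n]. *)
Definition ngon (F : fieldType) (n : nat) (P : polygon F) : Prop :=
  exists (p : 'I_n -> point F) (l : 'I_n -> line F),
    [/\ injective p, injective l,
        forall i : 'I_n, on_line (p i) (l i) /\ on_line (p (ordS i)) (l i)
      & P = (range p, range l)].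

Definition inscribed (F : fieldType) (f : {mpoly F[3]}) (P : polygon F) : Prop :=
  forall p : point F, P.1 p -> vanishes_at f p.

Definition circumscribed (F : fieldType) (f : {mpoly F[3]}) (P : polygon F) : Prop :=
  forall l : line F, P.2 l -> tangent f l.

(* Main.v *)
(** Parametrize [D] by [t |-> phi t = e0 + t e1 + t^2 e2] so that no vertex of
    the given polygon is at infinity.  The chord joining [phi x] and [phi y] is
    tangent to [C] iff [F x y = 0] for a symmetric polynomial
    [F x y = A x * y^2 + B x * y + C x] of degree 2 in each variable, and the
    vertices form a cycle [x_0, ..., x_n = x_0] with [F x_k x_(k+1) = 0].
    Put [G = B^2 - 4 A C] and [w_k = (dF/dy) (x_k, x_(k+1))], so that
    [w_k^2 = G x_k].  Since [x_(k-1)] and [x_(k+1)] are the two distinct roots of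
    [F x_k], the differential [dx_k / w_k] does not depend on [k].  Deform [x_0]
    to [X_0 = x_0 + s] over the formal power series in [s], lift [w_0] to a square
    root [W_0] of [G X_0], and propagate to [X_k], [W_k].  Then all the [X_k] solve
    [W_0 X' = W], [W^2 = G X], which is determined by its initial conditions, so
    [x_n = x_0] and [w_n = w_0] force [X_n = X_0].  Finally the [X_k] are rational
    in [X_0] and [W_0], and specializing [X_0] to all but finitely many constants
    yields infinitely many cycles. *)
Require Import Defs.
From HB Require Import structures.
From mathcomp Require Import all_boot all_order all_algebra.
From mathcomp Require Import classical_sets functions cardinality reals.
From mathcomp Require Import complex mpoly.
From mathcomp Require Import boolp ring.
Set Implicit Arguments.
Unset Strict Implicit.
Unset Printing Implicit Defensive.
Import GRing.Theory.
Local Open Scope ring_scope.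
Local Open Scope classical_set_scope.

(** * Formal power series *)

Section PowerSeries.
Variable K : fieldType.

Record fps := Fps { fcoef : nat -> K }.

Implicit Types f g h : fps.

Lemma fpsP f g : (forall n, fcoef f n = fcoef g n) -> f = g.
Proof. by case: f g => [f] [g] /= fg; congr Fps; apply/funext. Qed.

HB.instance Definition _ := gen_eqMixin fps.
HB.instance Definition _ := gen_choiceMixin fps.

Definition fps_poly (p : {poly K}) : fps := Fps (fun n => p`_n).
Definition fps_trunc n f : {poly K} := \poly_(i < n.+1) fcoef f i.

Definition fps_opp f := Fps (fun n => - fcoef f n).
Definition fps_add f g := Fps (fun n => fcoef f n + fcoef g n).
Definition fps_mul f g :=
  Fps (fun n => \sum_(i < n.+1) fcoef f i * fcoef g (n - i)).

Lemma fps_addA : associative fps_add.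
Proof. by move=> f g h; apply: fpsP => n /=; rewrite addrA. Qed.
Lemma fps_addC : commutative fps_add.
Proof. by move=> f g; apply: fpsP => n /=; rewrite addrC. Qed.
Lemma fps_add0 : left_id (fps_poly 0) fps_add.
Proof. by move=> f; apply: fpsP => n /=; rewrite coef0 add0r. Qed.
Lemma fps_addN : left_inverse (fps_poly 0) fps_opp fps_add.
Proof. by move=> f; apply: fpsP => n /=; rewrite coef0 addNr. Qed.

HB.instance Definition _ :=
  GRing.isZmodule.Build fps fps_addA fps_addC fps_add0 fps_addN.

(** Coefficient [n] of a product depends only on coefficients up to [n], so ring identities and the
    Leibniz rule can be checked on truncations, where they hold in [{poly K}]. *)
Definition fps_low n f (p : {poly K}) := forall i, (i <= n)%N -> fcoef f i = p`_i.

Lemma fps_low_trunc n f : fps_low n f (fps_trunc n f).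
Proof. by move=> i lein; rewrite coef_poly ltnS lein. Qed.

Lemma fps_low_mul n f g p q :
  fps_low n f p -> fps_low n g q -> fps_low n (fps_mul f g) (p * q).
Proof.
move=> fp gq i lein; rewrite coefM /=; apply: eq_bigr => j _.
by rewrite fp ?gq //; apply: leq_trans lein; rewrite ?leq_subr // -ltnS.
Qed.

Lemma fps_low_eq n f g p : fps_low n f p -> fps_low n g p -> fcoef f n = fcoef g n.
Proof. by move=> fp gp; rewrite fp ?gp. Qed.

Lemma fps_mulA : associative fps_mul.
Proof.
move=> f g h; apply: fpsP => n.
have [F G H] := And3 (@fps_low_trunc n f) (@fps_low_trunc n g) (@fps_low_trunc n h).
apply: fps_low_eq (fps_low_mul F (fps_low_mul G H)) _; rewrite mulrA.
exact: fps_low_mul (fps_low_mul F G) H.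
Qed.

Lemma fps_mulC : commutative fps_mul.
Proof.
move=> f g; apply: fpsP => n.
have [F G] := conj (@fps_low_trunc n f) (@fps_low_trunc n g).
by apply: fps_low_eq (fps_low_mul F G) _; rewrite mulrC; apply: fps_low_mul.
Qed.

Lemma fps_mul1 : left_id (fps_poly 1) fps_mul.
Proof.
move=> f; apply: fpsP => n; have F := @fps_low_trunc n f.
apply: fps_low_eq F; rewrite -[fps_trunc n f]mul1r.
exact: fps_low_mul (@fps_low_trunc n f).
Qed.

Lemma fps_mulDl : left_distributive fps_mul fps_add.
Proof.
move=> f g h; apply: fpsP => n /=; rewrite -big_split /=.
by apply: eq_bigr => i _; rewrite mulrDl.
Qed.

Lemma fps_one_neq0 : fps_poly 1 != 0.
Proof.
apply/eqP => /(congr1 (fun f => fcoef f 0)) /=; rewrite coef1 coef0 /=.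
exact/eqP/oner_neq0.
Qed.

HB.instance Definition _ := GRing.Zmodule_isComNzRing.Build fps
  fps_mulA fps_mulC fps_mul1 fps_mulDl fps_one_neq0.

Lemma fcoefM f g n : fcoef (f * g) n = \sum_(i < n.+1) fcoef f i * fcoef g (n - i).
Proof. by []. Qed.

Lemma fps_mulf_eq0 f g : f * g = 0 -> (f == 0) || (g == 0).
Proof.
move=> fg0; apply/norP => -[f0 g0].
have lowest h : h != 0 ->
    exists2 n, fcoef h n != 0 & forall i, (i < n)%N -> fcoef h i = 0.
  move=> h0; have: exists n, fcoef h n != 0.
    apply/not_existsP => hn; move/eqP: h0; apply; apply: fpsP => n.
    by rewrite /= coef0; apply: contrapT => /eqP; apply: hn.
  case/ex_minnP => n hn nmin; exists n => // i; rewrite ltnNge => ltin.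
  by apply/eqP; apply: contraNT ltin; apply: nmin.
have [m fm fmin] := lowest _ f0; have [n gn gmin] := lowest _ g0.
have: fcoef (f * g) (m + n) = 0 by rewrite fg0 /= coef0.
have ltm : (m < (m + n).+1)%N by rewrite ltnS leq_addr.
rewrite fcoefM (bigD1 (Ordinal ltm)) //= big1 ?addr0 => [/eqP|i neim].
  by rewrite addKn mulf_eq0 (negPf fm) (negPf gn).
have [ltim|] := ltnP i m; first by rewrite fmin ?mul0r.
rewrite leq_eqVlt => /predU1P[eqmi|ltmi].
  by case/eqP: neim; apply/val_inj.
rewrite gmin ?mulr0 //; have := ltn_ord i; rewrite ltnS => lei.
by rewrite ltn_subLR // ltn_add2r.
Qed.

(** Serves to solve for inverses and square roots one coefficient at a time. In the proof, [s n]
    lists the first [n] values. *)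
Lemma course_of_values (Phi : nat -> (nat -> K) -> K) :
    (forall n (g h : nat -> K), (forall i, (i < n)%N -> g i = h i) -> Phi n g = Phi n h) ->
  exists g : nat -> K, forall n, g n = Phi n g.
Proof.
move=> PhiE; pose s n := iteri n (fun n s => rcons s (Phi n (nth 0 s))) [::].
have sE n : size (s n) = n by elim: n => //= n IHn; rewrite size_rcons IHn.
pose g n := nth 0 (s n.+1) n; exists g => n.
rewrite {1}/g /= nth_rcons sE ltnn eqxx; apply: PhiE => i.
elim: n => // n IHn; rewrite ltnS leq_eqVlt => /predU1P[-> //|ltin].
by rewrite /= nth_rcons sE ltin IHn.
Qed.

Lemma fps_inv_ex f : fcoef f 0 != 0 -> exists g, g * f = 1.
Proof.
move=> f0; pose Phi n (g : nat -> K) :=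
  ((n == 0)%:R - \sum_(i < n) g i * fcoef f (n - i)) / fcoef f 0.
have [n g h gh|g gE] := @course_of_values Phi.
  by rewrite /Phi; congr (_ * _); congr (_ - _); apply: eq_bigr => i _; rewrite gh.
exists (Fps g); apply: fpsP => n; rewrite fcoefM big_ord_recr /= subnn gE.
by rewrite /Phi divfK // addrC subrK coef1.
Qed.

Lemma fps_sqrt_ex f (c : K) : (2%:R : K) != 0 -> c != 0 -> fcoef f 0 = c ^+ 2 ->
  exists2 g, g ^+ 2 = f & fcoef g 0 = c.
Proof.
move=> two0 c0 f0; pose Phi n (g : nat -> K) :=
  if n is m.+1 then
    (fcoef f n - \sum_(i < m) g i.+1 * g (m - i)%N) / (2%:R * c)
  else c.
have [[|n] g h gh|g gE] := @course_of_values Phi; first by [].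
  rewrite /Phi; congr (_ * _); congr (_ - _); apply: eq_bigr => i _.
  by rewrite !gh // ltnS ?leq_subr.
exists (Fps g) => /=; last by rewrite gE.
apply: fpsP => n; rewrite expr2 fcoefM.
case: n => [|n]; first by rewrite big_ord1 /= (gE 0%N) -expr2 f0.
rewrite big_ord_recl big_ord_recr /= subn0 subnn (gE 0%N) [g n.+1]gE /= .
by field; rewrite c0 two0.
Qed.

Definition fps_unit : pred fps := [pred f | `[< exists g, g * f = 1 >]].
(** Classical choice of an inverse; off the units it is the identity, as the unit ring structure
    demands. *)
Definition fps_inv f : fps :=
  if pselect (exists g, g * f = 1) is left fP then projT1 (cid fP) else f.

Lemma fps_mulVf : {in fps_unit, left_inverse 1 fps_inv *%R}.
Proof.
move=> f /asboolP fP; rewrite /fps_inv; case: pselect => // fP'.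
exact: (projT2 (cid fP')).
Qed.

Lemma fps_unitPl f g : g * f = 1 -> fps_unit f.
Proof. by move=> gf; apply/asboolP; exists g. Qed.

Lemma fps_inv_out : {in [predC fps_unit], fps_inv =1 id}.
Proof. by move=> f /asboolP fP; rewrite /fps_inv; case: pselect. Qed.

HB.instance Definition _ :=
  GRing.ComNzRing_hasMulInverse.Build fps fps_mulVf fps_unitPl fps_inv_out.
HB.instance Definition _ := GRing.ComUnitRing_isIntegral.Build fps fps_mulf_eq0.

Definition fps_cst f : K := fcoef f 0.

Lemma fps_cst_is_zmod_morphism : zmod_morphism fps_cst.
Proof. by []. Qed.
Lemma fps_cst_is_monoid_morphism : monoid_morphism fps_cst.
Proof. by split=> [|f g]; rewrite /fps_cst ?fcoefM ?big_ord1 //= coef1. Qed.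
HB.instance Definition _ :=
  GRing.isZmodMorphism.Build fps K fps_cst fps_cst_is_zmod_morphism.
HB.instance Definition _ :=
  GRing.isMonoidMorphism.Build fps K fps_cst fps_cst_is_monoid_morphism.

Lemma fps_poly_is_zmod_morphism : zmod_morphism fps_poly.
Proof. by move=> p q; apply: fpsP => n /=; rewrite coefB. Qed.
Lemma fps_poly_is_monoid_morphism : monoid_morphism fps_poly.
Proof. by split=> // p q; apply: fpsP => n; rewrite fcoefM /= coefM. Qed.
HB.instance Definition _ :=
  GRing.isZmodMorphism.Build {poly K} fps fps_poly fps_poly_is_zmod_morphism.
HB.instance Definition _ :=
  GRing.isMonoidMorphism.Build {poly K} fps fps_poly fps_poly_is_monoid_morphism.

Lemma fps_poly_inj : injective fps_poly.
Proof. by move=> p q pq; apply/polyP => n; move/(congr1 (fcoef^~ n)): pq. Qed.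

Lemma fps_unitE f : fps_cst f != 0 -> f \is a GRing.unit.
Proof. by move=> /fps_inv_ex fP; apply/asboolP. Qed.

Definition fps_deriv f := Fps (fun n => fcoef f n.+1 *+ n.+1).

Lemma fps_deriv_is_zmod_morphism : zmod_morphism fps_deriv.
Proof. by move=> f g; apply: fpsP => n /=; rewrite mulrnBl. Qed.
HB.instance Definition _ :=
  GRing.isZmodMorphism.Build fps fps fps_deriv fps_deriv_is_zmod_morphism.

Lemma fps_low_deriv n f p : fps_low n.+1 f p -> fps_low n (fps_deriv f) p^`().
Proof. by move=> fp i lein /=; rewrite coef_deriv fp. Qed.

Lemma fps_derivM f g : fps_deriv (f * g) = fps_deriv f * g + f * fps_deriv g.
Proof.
apply: fpsP => n.
have [F G] := conj (@fps_low_trunc n.+1 f) (@fps_low_trunc n.+1 g).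
have low h p : fps_low n.+1 h p -> fps_low n h p.
  by move=> hp i lein; apply: hp; apply: leqW.
have := fps_low_deriv (fps_low_mul F G); rewrite derivM => FG.
rewrite (FG n) // coefD; congr (_ + _); apply/esym.
  exact: (fps_low_mul (fps_low_deriv F) (low _ _ G)).
exact: (fps_low_mul (low _ _ F) (fps_low_deriv G)).
Qed.

Lemma fps_deriv_polyC c : fps_deriv (fps_poly c%:P) = 0.
Proof. by apply: fpsP => n /=; rewrite coefC coef0 mul0rn. Qed.

Lemma fps_deriv_poly p : fps_deriv (fps_poly p) = fps_poly p^`().
Proof. by apply: fpsP => n /=; rewrite coef_deriv. Qed.

(* If [f <> 0] has order [n > 0], then [a * f'] has order [n - 1] and
   [b * f] order at least [n]. *)
Lemma fps_linear_ode f a b : [pchar K] =i pred0 ->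
  fps_cst a != 0 -> a * fps_deriv f = b * f -> fps_cst f = 0 -> f = 0.
Proof.
move=> char0 a0 ode f0; apply: fpsP => n; rewrite /= coef0.
elim/ltn_ind: n => -[//|n] IHn.
have := congr1 (fcoef^~ n) ode; rewrite !fcoefM big_ord_recl /= subn0.
rewrite big1 => [|i _]; last first.
  by rewrite /= IHn ?mul0rn ?mulr0 // ltnS ltn_subrL (leq_ltn_trans _ (ltn_ord i)).
rewrite big1 => [|i _]; last by rewrite IHn ?mulr0 // ltnS leq_subr.
move/eqP; rewrite addr0 mulf_eq0 (negPf a0) -mulr_natr mulf_eq0.
by rewrite ((pcharf0P K).1 char0) orbF => /eqP.
Qed.

End PowerSeries.

(** * Specialization of a quadratic extension of a rational function field *)

Section FractionImage.
Variables (S R : idomainType) (e : {rmorphism S -> R}).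

(** Membership of [x] in the fraction field of the image of [e], stated with the denominator
    cleared. *)
Definition frac_image (x : R) := exists p q, e q != 0 /\ e q * x = e p.

Lemma frac_image_morph p : frac_image (e p).
Proof. by exists p, 1; rewrite rmorph1 oner_neq0 mul1r. Qed.

Lemma frac_imageD x y : frac_image x -> frac_image y -> frac_image (x + y).
Proof.
move=> [p [q [q0 ex]]] [r [s [s0 ey]]]; exists (p * s + r * q), (q * s).
by rewrite rmorphD !rmorphM mulf_neq0 // -ex -ey; split=> //; ring.
Qed.

Lemma frac_imageM x y : frac_image x -> frac_image y -> frac_image (x * y).
Proof.
move=> [p [q [q0 ex]]] [r [s [s0 ey]]]; exists (p * r), (q * s).
by rewrite !rmorphM mulf_neq0 // -ex -ey; split=> //; ring.
Qed.

Lemma frac_imageN x : frac_image x -> frac_image (- x).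
Proof. by move=> [p [q [q0 ex]]]; exists (- p), q; rewrite rmorphN mulrN ex. Qed.

Lemma frac_imageV x : x \is a GRing.unit -> frac_image x -> frac_image x^-1.
Proof.
move=> xu [p [q [q0 ex]]]; exists q, p; rewrite -ex mulrK //; split=> //.
by rewrite mulf_neq0 //; apply: contraTneq xu => ->; rewrite unitr0.
Qed.

End FractionImage.

Section Specialization.
Variables (K : closedFieldType) (R : idomainType).
Variables (G : {poly K}) (e : {rmorphism {poly {poly K}} -> R}).
Hypothesis e_inj : forall p : {poly K}, e p%:P = 0 -> p = 0.
Hypothesis e_sqrt : e 'X ^+ 2 = e G%:P.

(** Reduction of [T] modulo [X ^ 2 - G]. The same [U] and [V] serve for [e] and for every point
    [(a, b)] of the curve [b ^ 2 = G a]. *)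
Lemma affine_mod_sqrt (T : {poly {poly K}}) : exists U V : {poly K},
  e T = e U%:P + e V%:P * e 'X /\
  forall a b, b ^+ 2 = G.[a] -> T.[b%:P].[a] = U.[a] + V.[a] * b.
Proof.
elim/poly_ind: T => [|T c [U [V [eT hT]]]].
  by exists 0, 0; rewrite rmorph0 mul0r addr0; split=> // a b _; rewrite !hornerE.
exists (V * G + c), U; split=> [|a b ba].
  by rewrite rmorphD rmorphM eT polyCD polyCM rmorphD rmorphM -e_sqrt; ring.
by rewrite hornerMXaddC !hornerE hT // -ba; ring.
Qed.

(** Here the square root [e 'X] is the fraction [P / Q], so [b = P a / Q a] is forced: the other
    root may break relations in the kernel of [e]. The polynomial [h] excludes the zeros of [Q] and
    of the numerator of [S]. *)
Lemma specialization_ratl (P Q : {poly K}) S :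
  Q != 0 -> e P%:P = e Q%:P * e 'X -> e S != 0 ->
  exists2 h : {poly K}, h != 0 & forall a, h.[a] != 0 ->
    exists b, S.[b%:P].[a] != 0 /\ forall T, e T = 0 -> T.[b%:P].[a] = 0.
Proof.
move=> Q0 ePQ eS0.
have PQ : P ^+ 2 = Q ^+ 2 * G.
  apply/eqP; rewrite -subr_eq0; apply/eqP/e_inj.
  by rewrite !expr2 polyCB rmorphB !polyCM !rmorphM -e_sqrt ePQ; ring.
have key U V : e Q%:P * (e U%:P + e V%:P * e 'X) = e (Q * U + V * P)%:P.
  by rewrite polyCD !polyCM rmorphD !rmorphM ePQ; ring.
have [U [V [eS hS]]] := affine_mod_sqrt S.
have h0 : Q * U + V * P != 0.
  apply: contra_neq eS0 => QUVP; apply/eqP; have := key U V; rewrite QUVP.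
  rewrite rmorph0 -eS => /eqP; rewrite mulf_eq0 => /predU1P[/e_inj /eqP|//].
  by rewrite (negPf Q0).
exists (Q * (Q * U + V * P)) => [|a]; first by rewrite mulf_neq0.
rewrite hornerM mulf_eq0 => /norP[Qa ha]; exists (P.[a] / Q.[a]).
have ba : (P.[a] / Q.[a]) ^+ 2 = G.[a].
  by rewrite expr_div_n -horner_exp PQ hornerM horner_exp mulrC mulKf ?expf_neq0.
have ev U1 V1 : U1.[a] + V1.[a] * (P.[a] / Q.[a]) = (Q * U1 + V1 * P).[a] / Q.[a].
  by rewrite !(hornerD, hornerM); field.
split=> [|T eT]; first by rewrite hS // ev mulf_neq0 ?invr_eq0.
have [U1 [V1 [eT1 ->]]] := affine_mod_sqrt T; rewrite // ev.
have := key U1 V1; rewrite -eT1 eT mulr0 => /esym/e_inj ->.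
by rewrite horner0 mul0r.
Qed.

(** If the square root is not rational, then [1] and [e 'X] are independent over the polynomials, so
    a relation [T] reduces to [U = V = 0] and either root of [b ^ 2 = G a] will do. Nonvanishing of
    [S] is then controlled by its norm [U ^ 2 - V ^ 2 G]. *)
Lemma specialization S : e S != 0 ->
  exists2 h : {poly K}, h != 0 & forall a, h.[a] != 0 ->
    exists b, S.[b%:P].[a] != 0 /\ forall T, e T = 0 -> T.[b%:P].[a] = 0.
Proof.
move=> eS0.
have [[[P Q] /= [Q0 ePQ]]|noPQ] :=
    pselect (exists PQ : {poly K} * {poly K}, PQ.2 != 0 /\ e PQ.1%:P = e PQ.2%:P * e 'X).
  exact: specialization_ratl ePQ eS0.
have free U V : e U%:P = e V%:P * e 'X -> U = 0 /\ V = 0.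
  move=> UV; have V0 : V = 0.
    by apply/eqP/negP => /negP V0; apply: noPQ; exists (U, V).
  by move: UV; rewrite V0 rmorph0 mul0r => /e_inj.
have [U [V [eS hS]]] := affine_mod_sqrt S.
exists (U ^+ 2 - V ^+ 2 * G) => [|a ha].
  apply: contra_neq eS0 => UV.
  have : (e U%:P - e V%:P * e 'X) * e S = e (U ^+ 2 - V ^+ 2 * G)%:P.
    by rewrite eS !expr2 polyCB rmorphB !polyCM !rmorphM -e_sqrt; ring.
  rewrite UV rmorph0 => /eqP; rewrite mulf_eq0 => /predU1P[/subr0_eq/free[U0 V0]|/eqP //].
  by rewrite eS U0 V0 rmorph0 mul0r addr0.
have [b] := @solve_monicpoly K 2 (fun i => if i is 0%N then G.[a] else 0) isT.
rewrite !big_ord_recl big_ord0 mul0r !addr0 mulr1 => ba; exists b.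
split=> [|T eT].
  rewrite hS //; apply: contra_neq ha => UV; rewrite !hornerE -ba.
  by rewrite (_ : U.[a] = - (V.[a] * b)); [ring | apply/eqP; rewrite -addr_eq0 UV].
have [U1 [V1 [eT1 ->]]] := affine_mod_sqrt T; rewrite //.
have [] := free U1 (- V1).
  by apply/eqP; rewrite -subr_eq0 polyCN rmorphN mulNr opprK -eT1 eT.
by move=> -> /eqP; rewrite oppr_eq0 => /eqP->; rewrite horner0 mul0r addr0.
Qed.

End Specialization.

(** * Symmetric biquadratic forms *)

Section Biquadratic.
Variables (K : fieldType) (a b c d l m : K).

Section Forms.
Variables (R : comNzRingType) (f : {rmorphism K -> R}).

(** The coefficients pass through a morphism [f], so that one form can be evaluated in [K], in power
    series and in polynomials. Sharing [b], [c] and [l] between [bqA], [bqB] and [bqC] makes it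
    symmetric. *)
Definition bqA x := f a * x ^+ 2 + f b * x + f c.
Definition bqB x := f b * x ^+ 2 + f d * x + f l.
Definition bqC x := f c * x ^+ 2 + f l * x + f m.
Definition bq x y := bqA x * y ^+ 2 + bqB x * y + bqC x.
Definition bq_discr x := bqB x ^+ 2 - 4%:R * bqA x * bqC x.
Definition bq_dy x y := 2%:R * bqA x * y + bqB x.

(** Bihomogenization of [bq] at [(p : q)] and [(r : s)], for evaluation at fractions with
    denominators cleared. *)
Definition bq_hom p q r s :=
  f a * (p * r) ^+ 2 + f b * (p * r) * (p * s + r * q) +
  f c * ((p * s) ^+ 2 + (r * q) ^+ 2) + f d * (p * q * r * s) +
  f l * (q * s) * (p * s + r * q) + f m * (q * s) ^+ 2.

Lemma bq_homE p q r s x y : p = q * x -> r = s * y ->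
  bq_hom p q r s = (q * s) ^+ 2 * bq x y.
Proof. by move=> -> ->; rewrite /bq_hom /bq /bqA /bqB /bqC; ring. Qed.

Lemma bq_sym x y : bq x y = bq y x.
Proof. by rewrite /bq /bqA /bqB /bqC; ring. Qed.

Lemma bq_dy_sqr x y : bq_dy x y ^+ 2 = bq_discr x + 4%:R * bqA x * bq x y.
Proof. by rewrite /bq_dy /bq_discr /bq; ring. Qed.

(** Divided difference of the quartic [bq_discr], whose coefficients in degrees 4, 3, 2, 1 are [u],
    [v], [w], [z]. *)
Definition bq_discr_slope (x y : R) : R :=
  let u := f b ^+ 2 - 4%:R * f a * f c in
  let v := 2%:R * f b * f d - 4%:R * (f a * f l + f b * f c) in
  let w := f d ^+ 2 + 2%:R * f b * f l
           - 4%:R * (f a * f m + f b * f l + f c ^+ 2) in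
  let z := 2%:R * f d * f l - 4%:R * (f b * f m + f c * f l) in
  u * (x + y) * (x ^+ 2 + y ^+ 2) + v * (x ^+ 2 + x * y + y ^+ 2) +
  w * (x + y) + z.

Lemma bq_discrB x y :
  bq_discr x - bq_discr y = bq_discr_slope x y * (x - y).
Proof. by rewrite /bq_discr /bq_discr_slope /bqA /bqB /bqC /=; ring. Qed.

End Forms.

Section Morphism.
Variables (R R' : comNzRingType) (f : {rmorphism K -> R}) (f' : {rmorphism K -> R'}).
Variable (g : {rmorphism R -> R'}).
Hypothesis gf : forall k, g (f k) = f' k.

Lemma rmorph_bqA x : g (bqA f x) = bqA f' (g x).
Proof. by rewrite !(rmorphD, rmorphM, rmorphXn) /= !gf. Qed.
Lemma rmorph_bqB x : g (bqB f x) = bqB f' (g x).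
Proof. by rewrite !(rmorphD, rmorphM, rmorphXn) /= !gf. Qed.
Lemma rmorph_bqC x : g (bqC f x) = bqC f' (g x).
Proof. by rewrite !(rmorphD, rmorphM, rmorphXn) /= !gf. Qed.
Lemma rmorph_bq_discr x : g (bq_discr f x) = bq_discr f' (g x).
Proof.
rewrite /bq_discr rmorphB !rmorphM rmorph_bqA rmorph_bqB rmorph_bqC.
by rewrite rmorph_nat.
Qed.
Lemma rmorph_bq_dy x y : g (bq_dy f x y) = bq_dy f' (g x) (g y).
Proof. by rewrite rmorphD !rmorphM rmorph_bqA rmorph_bqB rmorph_nat. Qed.
Lemma rmorph_bq_hom p q r s :
  g (bq_hom f p q r s) = bq_hom f' (g p) (g q) (g r) (g s).
Proof. by rewrite !(rmorphD, rmorphM, rmorphXn) /= !gf. Qed.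

End Morphism.

(* Vieta: [y] and [z] are the two roots of [bq x]. *)
Lemma bq_dy_vieta x y z : y != z ->
  bq idfun x y = 0 -> bq idfun x z = 0 -> bq_dy idfun x z = - bq_dy idfun x y.
Proof.
move=> yz xy xz; apply/eqP; rewrite -addr_eq0; apply/eqP/(@mulfI _ (z - y)).
  by rewrite subr_eq0 eq_sym.
rewrite mulr0; transitivity (2%:R * (bq idfun x z - bq idfun x y)).
  by rewrite /bq /bq_dy; ring.
by rewrite xy xz subrr mulr0.
Qed.

(** Derivative at the root [y] of the quadratic with leading coefficient [bqA x] and roots [y], [z].
    It shows that [w_k] is nonzero once the neighbours of a vertex differ. *)
Lemma bq_dyE x y z : y != z -> bq idfun x y = 0 -> bq idfun x z = 0 ->
  bq_dy idfun x y = bqA idfun x * (y - z).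
Proof.
move=> yz xy xz; apply: (@mulfI _ (y - z)); first by rewrite subr_eq0.
have -> : (y - z) * bq_dy idfun x y =
   (y - z) * (bqA idfun x * (y - z)) + (bq idfun x y - bq idfun x z).
  by rewrite /bq /bq_dy; ring.
by rewrite xy xz subrr addr0.
Qed.

End Biquadratic.

(** * Deformation of a cycle *)

Section Deformation.
Variables (K : closedFieldType) (a b c d l m : K).
Hypothesis char0 : [pchar K] =i pred0.

Let natr_neq0 n : (n.+1%:R : K) != 0.
Proof. by rewrite ((pcharf0P K).1 char0). Qed.

Let fC : {rmorphism K -> fps K} := @fps_poly K \o polyC.
Let cst : {rmorphism fps K -> K} := @fps_cst K.

Let cst_fC k : cst (fC k) = idfun k.
Proof. by rewrite /= /fps_cst /= coefC. Qed.

Let D_fC k : fps_deriv (fC k) = 0.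
Proof. exact: fps_deriv_polyC. Qed.

Let D_add (X Y : fps K) : fps_deriv (X + Y) = fps_deriv X + fps_deriv Y.
Proof. exact: raddfD. Qed.

Let cst_neq0 (X : fps K) : cst X != 0 -> X != 0.
Proof. by apply: contra_neq => ->; rewrite rmorph0. Qed.

Let D_exp2 (X : fps K) : fps_deriv (X ^+ 2) = 2%:R * X * fps_deriv X.
Proof. by rewrite expr2 fps_derivM; ring. Qed.

Local Notation A := (bqA a b c).
Local Notation B := (bqB b d l).
Local Notation F := (bq a b c d l m).
Local Notation G := (bq_discr a b c d l m).
Local Notation F2 := (bq_dy a b c d l).

Let D_F X Y :
  fps_deriv (F fC X Y) = F2 fC Y X * fps_deriv X + F2 fC X Y * fps_deriv Y.
Proof.
rewrite /bq /bq_dy /bqA /bqB /bqC.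
by rewrite !(D_add, fps_derivM, D_exp2, D_fC); ring.
Qed.

(** The equation defining [Y] is linear, and completing the square with [W ^ 2 = G X] turns it into
    [F X Y = 0]. The sign in the next root [- F2 Y X] comes from Vieta at [y], whose neighbours are
    [x] and [z]. *)
Lemma fps_next_side (W0 X Y W : fps K) (x y z : K) :
    A idfun x != 0 -> F idfun x y = 0 -> F idfun y z = 0 -> x != z ->
    F2 idfun x y != 0 ->
    cst X = x -> cst W = F2 idfun x y -> W ^+ 2 = G fC X ->
    W0 * fps_deriv X = W -> F2 fC X Y = W ->
  [/\ F fC X Y = 0, cst Y = y, cst (- F2 fC Y X) = F2 idfun y z,
      (- F2 fC Y X) ^+ 2 = G fC Y & W0 * fps_deriv Y = - F2 fC Y X].
Proof.
move=> Ax xy yz xz dxy cX cW W2 DX EY.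
have A0 : 4%:R * A fC X != 0.
  apply: cst_neq0; rewrite rmorphM rmorph_nat (rmorph_bqA _ _ _ cst_fC) cX.
  by rewrite mulf_neq0 ?natr_neq0.
have FXY : F fC X Y = 0.
  apply: (mulfI A0); apply: (@addrI _ (G fC X)).
  by rewrite -(@bq_dy_sqr _ a b c d l m) EY W2 mulr0 addr0.
have cY : cst Y = y.
  have : 2%:R * A idfun x * cst Y = 2%:R * A idfun x * y.
    have := congr1 cst EY; rewrite (rmorph_bq_dy _ _ _ _ _ cst_fC) cX cW.
    by rewrite /bq_dy => /addIr.
  by move/mulfI; apply; rewrite mulf_neq0 ?natr_neq0.
split=> //.
- rewrite rmorphN (rmorph_bq_dy _ _ _ _ _ cst_fC) cX cY.
  by rewrite (@bq_dy_vieta _ a b c d l m _ _ _ xz) ?opprK // bq_sym.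
- by rewrite sqrrN (@bq_dy_sqr _ a b c d l m) bq_sym FXY mulr0 addr0.
(* Differentiating [F X Y = 0] gives [F2 Y X * X' + W * Y' = 0]; multiply by [W0], use [W0 * X' = W]
   and cancel [W]. *)
- have W0' : W != 0 by apply: cst_neq0; rewrite cW.
  apply: (mulfI W0'); have := congr1 (fun U => W0 * fps_deriv U) FXY.
  rewrite D_F EY raddf0 mulr0 mulrDr mulrCA DX => FD.
  by apply/eqP; rewrite -subr_eq0 -[X in _ == X]FD; apply/eqP; ring.
Qed.

(** Iteration of [fps_next_side]. The recursions for [X] and [W] stay in the conclusion because they
    show that all terms are rational in [X 0] and [W 0]. *)
Lemma fps_arc (x : nat -> K) :
    (forall k, A idfun (x k) != 0) -> (forall k, F idfun (x k) (x k.+1) = 0) ->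
    (forall k, x k != x k.+2) -> F2 idfun (x 0%N) (x 1%N) != 0 ->
  exists X W : nat -> fps K,
  [/\ X 0%N = fps_poly ('X + (x 0%N)%:P), forall k, F fC (X k) (X k.+1) = 0,
      forall k, X k.+1 = (W k - B fC (X k)) / (2%:R * A fC (X k)),
      forall k, W k.+1 = - F2 fC (X k.+1) (X k)
    & forall k, [/\ 2%:R * A fC (X k) \is a GRing.unit,
        cst (X k) = x k, cst (W k) = F2 idfun (x k) (x k.+1),
        W k ^+ 2 = G fC (X k) & W 0%N * fps_deriv (X k) = W k]].
Proof.
move=> Ax xx xz d0.
pose X0 : fps K := fps_poly ('X + (x 0%N)%:P).
have cX0 : cst X0 = x 0%N.
  by rewrite /= /fps_cst /= coefD coefX coefC add0r.
have DX0 : fps_deriv X0 = 1.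
  by rewrite fps_deriv_poly derivD derivX derivC addr0 rmorph1.
have [|W0 W02 cW0] := fps_sqrt_ex (natr_neq0 1) d0 (f := G fC X0).
  rewrite -[LHS]/(cst _) (rmorph_bq_discr _ _ _ _ _ _ cst_fC) cX0 (@bq_dy_sqr _ a b c d l m).
  by rewrite xx mulr0 addr0.
pose next (XW : fps K * fps K) :=
  let Y := (XW.2 - B fC XW.1) / (2%:R * A fC XW.1) in (Y, - F2 fC Y XW.1).
pose XW k := iter k next (X0, W0).
have uA k : cst (XW k).1 = x k -> 2%:R * A fC (XW k).1 \is a GRing.unit.
  move=> cX; apply: fps_unitE.
  rewrite -/(cst _) rmorphM rmorph_nat (rmorph_bqA _ _ _ cst_fC) cX.
  by rewrite mulf_neq0 ?natr_neq0.
have EY k : cst (XW k).1 = x k -> F2 fC (XW k).1 (XW k.+1).1 = (XW k).2.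
  move=> cX; rewrite /bq_dy [(XW k.+1).1]/(_ / _).
  by rewrite [_ * (_ / _)]mulrCA mulrV ?uA // mulr1 subrK.
have IH k : [/\ cst (XW k).1 = x k, cst (XW k).2 = F2 idfun (x k) (x k.+1),
    (XW k).2 ^+ 2 = G fC (XW k).1 & W0 * fps_deriv (XW k).1 = (XW k).2].
  elim: k => [|k [cX cW W2 DX]]; first by rewrite /= DX0 mulr1.
  (* At [k = 0] this is a hypothesis; later it holds because the two neighbours of [x k] differ. *)
  have dk : F2 idfun (x k) (x k.+1) != 0.
    case: k {cX cW W2 DX} => // k.
    have xx' : F idfun (x k.+1) (x k) = 0 by rewrite bq_sym.
    have xz' : x k.+2 != x k by rewrite eq_sym.
    by rewrite (bq_dyE xz' (xx k.+1) xx') mulf_neq0 ?subr_eq0.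
  have [_ cY cV V2 DY] :=
    fps_next_side (Ax k) (xx k) (xx k.+1) (xz k) dk cX cW W2 DX (EY k cX).
  by split.
exists (fun k => (XW k).1), (fun k => (XW k).2); split=> // k.
  case: (IH k) => cX cW W2 DX; have A0 : 4%:R * A fC (XW k).1 != 0.
    apply: cst_neq0; rewrite rmorphM rmorph_nat (rmorph_bqA _ _ _ cst_fC) cX.
    by rewrite mulf_neq0 ?natr_neq0.
  apply: (mulfI A0); apply: (@addrI _ (G fC (XW k).1)).
  by rewrite -(@bq_dy_sqr _ a b c d l m) EY // W2 mulr0 addr0.
by case: (IH k) => cX cW W2 DX; split=> //; apply: uA.
Qed.

(* The invariant differential: all the [X k] satisfy [W 0 * X' = W] on the
   curve [W ^ 2 = G X], an equation determined by its initial conditions. *)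
Lemma fps_arc_closed (X W : nat -> fps K) n :
    cst (W 0%N) != 0 -> cst (X n) = cst (X 0%N) -> cst (W n) = cst (W 0%N) ->
    (forall k, W k ^+ 2 = G fC (X k)) ->
    (forall k, W 0%N * fps_deriv (X k) = W k) ->
  X n = X 0%N.
Proof.
move=> W0 cX cW W2 DX; apply/subr0_eq.
(* Subtraction gives [W 0 * (X n - X 0)' = W n - W 0]; times [W n + W 0], the right side becomes
   [G (X n) - G (X 0)], a multiple of [X n - X 0]. The constant term of the leading coefficient is
   [2 w_0 ^ 2]. *)
apply: (@fps_linear_ode K _ ((W n + W 0%N) * W 0%N)
  (bq_discr_slope a b c d l m fC (X n) (X 0%N)) char0).
- rewrite -/(cst _) rmorphM rmorphD cW -mulr2n mulf_neq0 // -mulr_natl.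
  by rewrite mulf_neq0 ?natr_neq0.
- rewrite -bq_discrB -!W2 -mulrA raddfB mulrBr !DX subr_sqr mulrC //.
- by rewrite -/(cst _) rmorphB cX subrr.
Qed.

Lemma nearby_cycles (x : nat -> K) n :
    (forall k, A idfun (x k) != 0) -> (forall k, F idfun (x k) (x k.+1) = 0) ->
    (forall k, x k != x k.+2) -> F2 idfun (x 0%N) (x 1%N) != 0 ->
    x n = x 0%N -> x n.+1 = x 1%N ->
    (forall i j, (i < j < n)%N -> x i != x j) ->
  exists2 h : {poly K}, h != 0 & forall s, h.[s] != 0 -> exists y : nat -> K,
    [/\ y 0%N = s, y n = y 0%N, forall k, (k < n)%N -> F idfun (y k) (y k.+1) = 0
      & forall i j, (i < j < n)%N -> y i != y j].
Proof.
move=> Ax xx xz d0 xn xn1 xinj.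
have [X [W [X0 FX Xrec Wrec XW]]] := fps_arc Ax xx xz d0.
have cX k : cst (X k) = x k by case: (XW k).
have cW k : cst (W k) = F2 idfun (x k) (x k.+1) by case: (XW k).
have Xn : X n = X 0%N.
  apply: (@fps_arc_closed X W); rewrite ?cX ?cW ?xn ?xn1 //.
    by move=> k; case: (XW k).
  by move=> k; case: (XW k).
(* The shift makes the inner variable stand for [X 0] itself, while the outer one stands for [W 0];
   specializing the inner variable to [s] thus puts the first parameter at [s]. *)
pose es : {rmorphism {poly K} -> fps K} :=
  @fps_poly K \o comp_poly ('X + (x 0%N)%:P).
pose e : {rmorphism {poly {poly K}} -> fps K} :=
  horner_eval (W 0%N) \o map_poly es.
have eC p : e p%:P = es p by rewrite /= /horner_eval map_polyC hornerC.
have eX : e 'X = W 0%N by rewrite /= /horner_eval map_polyX hornerX.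
have esX : es 'X = X 0%N by rewrite /= comp_polyX X0.
have eCC k : e (k%:P)%:P = fC k by rewrite eC /= comp_polyC.
have e_inj p : e p%:P = 0 -> p = 0.
  rewrite eC /= -(rmorph0 (@fps_poly K)) => /fps_poly_inj/eqP.
  by rewrite comp_poly_eq0 ?size_XaddC // => /eqP.
pose fP : {rmorphism K -> {poly K}} := polyC.
have e_sqrt : e 'X ^+ 2 = e (G fP 'X)%:P.
  rewrite eX eC (rmorph_bq_discr _ _ _ _ _ _ (_ : forall k, es (fP k) = fC k)).
    by rewrite esX; case: (XW 0%N).
  by move=> k; rewrite -eCC eC.
have fr_C k : frac_image e (fC k) by rewrite -eCC; apply: frac_image_morph.
have fr_XW k : frac_image e (X k) /\ frac_image e (W k).
  elim: k => [|k [fX fW]].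
    rewrite X0 -eX; split; last exact: frac_image_morph.
    rewrite -X0 -esX -eC.
    exact: frac_image_morph.
  have fr_nat j : frac_image e j%:R by rewrite -(rmorph_nat fC).
  have fr_B Y : frac_image e Y -> frac_image e (B fC Y).
    by move=> fY; do ![exact: fr_C | exact: fY | apply: frac_imageD | apply: frac_imageM].
  have fr_A Y : frac_image e Y -> frac_image e (A fC Y).
    by move=> fY; do ![exact: fr_C | exact: fY | apply: frac_imageD | apply: frac_imageM].
  have fX' : frac_image e (X k.+1).
    rewrite Xrec; apply: frac_imageM.
      by apply: frac_imageD => //; apply/frac_imageN/fr_B.
    apply: frac_imageV; first by case: (XW k).
    by apply: frac_imageM => //; apply: fr_A.
  split=> //; rewrite Wrec; apply: frac_imageN.
  apply: frac_imageD; last exact: fr_B.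
  by apply: frac_imageM => //; apply: frac_imageM => //; apply: fr_A.
have [p {}fr_XW] := choice (fun k => (fr_XW k).1).
have [q {}fr_XW] := choice fr_XW.
have q0 k : e (q k) != 0 by case: (fr_XW k).
have qX k : e (p k) = e (q k) * X k by case: (fr_XW k).
(* If [S] survives specialization, the denominators [q 0, ..., q n] stay nonzero and the fractions
   [p i / q i] with [i < n] stay distinct. *)
pose S := (\prod_(k < n.+1) q k) *
  \prod_(i < n) \prod_(j < n | (i < j)%N) (p i * q j - p j * q i).
have eS : e S != 0.
  rewrite rmorphM mulf_neq0 // rmorph_prod prodf_seq_neq0; apply/allP=> i _.
    exact: q0.
  rewrite implyTb.
  rewrite rmorph_prod prodf_seq_neq0; apply/allP=> j _; apply/implyP => ltij.
  rewrite rmorphB !rmorphM !qX.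
  have -> : e (q i) * X i * e (q j) - e (q j) * X j * e (q i) =
    e (q i) * e (q j) * (X i - X j) by ring.
  rewrite !mulf_neq0 // subr_eq0.
  have : x i != x j by rewrite xinj // ltij ltn_ord.
  by apply: contra_neq => XX; rewrite -!cX XX.
have [h h0 hS] := specialization e_inj e_sqrt eS.
exists h => // s /hS[w [Sw Tw]].
pose v : {rmorphism {poly {poly K}} -> K} := horner_eval s \o horner_eval w%:P.
have vE T : v T = T.[w%:P].[s] by [].
have vCC k : v (k%:P)%:P = idfun k by rewrite vE !hornerC.
(* Every polynomial identity between the power series passes to the specialized values. *)
have eqv T T' : e T = e T' -> v T = v T'.
  move=> TT; apply/subr0_eq; rewrite -rmorphB; apply: Tw.
  by rewrite rmorphB TT subrr.
move: Sw; rewrite -vE rmorphM mulf_eq0 => /norP[].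
rewrite !rmorph_prod !prodf_seq_neq0 => /allP qv /allP pv.
have {}qv k : (k <= n)%N -> v (q k) != 0.
  by move=> lekn; apply: (qv (Ordinal (lekn : k < n.+1)%N)); rewrite mem_index_enum.
have pE k : (k <= n)%N -> v (p k) = v (q k) * (v (p k) / v (q k)).
  by move=> /qv qk; rewrite mulrCA mulfV ?mulr1.
exists (fun k => v (p k) / v (q k)); split.
- have -> : v (p 0%N) = v ('X%:P * q 0%N).
    by apply: eqv; rewrite rmorphM eC esX qX mulrC.
  by rewrite rmorphM mulfK ?qv // vE hornerC hornerX.
- apply/eqP; rewrite eqr_div ?qv // -!rmorphM; apply/eqP/eqv.
  by rewrite !(rmorphM e) !qX Xn; ring.
- move=> k ltkn; have [qk qk1] := conj (qv _ (ltnW ltkn)) (qv _ ltkn).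
  apply: (@mulfI _ ((v (q k) * v (q k.+1)) ^+ 2)); first by rewrite expf_neq0 ?mulf_neq0.
  rewrite mulr0 -(bq_homE _ _ _ _ _ _ _ (pE _ (ltnW ltkn)) (pE _ ltkn)).
  pose fPP : {rmorphism K -> {poly {poly K}}} := polyC \o fP.
  rewrite -(rmorph_bq_hom _ _ _ _ _ _ (vCC : forall k, v (fPP k) = _)).
  rewrite -(rmorph0 v); apply: eqv; rewrite rmorph0.
  rewrite (rmorph_bq_hom _ _ _ _ _ _ (eCC : forall k, e (fPP k) = _)).
  by rewrite (bq_homE _ _ _ _ _ _ _ (qX _) (qX _)) FX mulr0.
- move=> i j /andP[ltij ltjn]; have ltin := ltn_trans ltij ltjn.
  have [qi qj] := conj (qv _ (ltnW ltin)) (qv _ (ltnW ltjn)).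
  rewrite eqr_div // -subr_eq0 -!rmorphM -rmorphB.
  have := pv (Ordinal ltin) (mem_index_enum _).
  rewrite implyTb rmorph_prod prodf_seq_neq0 => /allP pvi.
  by have := pvi (Ordinal ltjn) (mem_index_enum _); rewrite [(_ < _)%N]ltij.
Qed.

End Deformation.

(** * Quadrics as symmetric matrices *)

Section SymmetricForm.
Variable K : fieldType.
Local Notation V := 'rV[K]_3.
Implicit Types (M : 'M[K]_3) (u v w : V) (s t : K).

Definition bform M u v : K := (u *m M *m v^T) 0 0.

Lemma bformDl M u v w : bform M (u + v) w = bform M u w + bform M v w.
Proof. by rewrite /bform !mulmxDl mxE. Qed.

Lemma bformZl M t u v : bform M (t *: u) v = t * bform M u v.
Proof. by rewrite /bform -!scalemxAl mxE. Qed.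

Lemma bformDr M u v w : bform M u (v + w) = bform M u v + bform M u w.
Proof. by rewrite /bform linearD mulmxDr mxE. Qed.

Lemma bformZr M t u v : bform M u (t *: v) = t * bform M u v.
Proof. by rewrite /bform linearZ -scalemxAr mxE. Qed.

Definition bformE := (bformDl, bformDr, bformZl, bformZr).

Lemma bformC M u v : M^T = M -> bform M u v = bform M v u.
Proof.
move=> MT; rewrite /bform -[u *m M *m v^T]trmxK mxE.
by rewrite !trmx_mul trmxK MT mulmxA.
Qed.

(** Determinant of the form restricted to the span of [u] and [v]; its vanishing will express
    tangency. *)
Definition gram M u v : K := bform M u u * bform M v v - bform M u v ^+ 2.

Definition free2 u v := forall s t, s *: u + t *: v = 0 -> s = 0 /\ t = 0.
Definition free3 u v w :=
  forall r s t : K, r *: u + s *: v + t *: w = 0 -> [/\ r = 0, s = 0 & t = 0].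

End SymmetricForm.

Section Quadric.
Variable K : fieldType.

(** The matrix is not symmetrized, so that the monomial [X_i X_j] simply has [delta_mx i j];
    [homog2_matrix] symmetrizes. *)
Definition has_matrix (f : {mpoly K[3]}) :=
  exists q : 'M[K]_3,
    (forall v : 'rV[K]_3, f.@[v ord0] = \sum_i \sum_j q i j * (v ord0 i * v ord0 j)) /\
    forall (v : 'rV[K]_3) i,
      f^`M(i).@[v ord0] = \sum_j (q i j + q j i) * v ord0 j.

Lemma has_matrixX i j : has_matrix ('X_i * 'X_j).
Proof.
have subU k : (U_(k) - U_(k) = 0 :> 'X_{1..3})%MM.
  by rewrite -{1}[U_(k)%MM]add0m addmK.
exists (delta_mx i j); split=> v => [|k].
  rewrite mevalM !mevalXU (bigD1 i) //= (bigD1 j) //= big1 => [|j' nj].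
    rewrite big1 => [|i' ni]; first by rewrite !mxE !eqxx mul1r !addr0.
    by apply: big1 => j' _; rewrite !mxE (negPf ni) mul0r.
  by rewrite !mxE eqxx (negPf nj) mul0r.
rewrite mderivM !mderivX mevalD !mevalM !mevalZ !mevalXU !mnm1E.
under eq_bigr do rewrite mulrDl.
rewrite big_split /=; congr (_ + _).
  rewrite (bigD1 j) //= big1 => [|j' nj]; last by rewrite mxE (negPf nj) andbF mul0r.
  rewrite mxE eqxx andbT addr0 eq_sym; case: eqP => [->|_]; last by rewrite !mul0r.
  by rewrite subU mpolyX0 meval1 mulr1.
rewrite (bigD1 i) //= big1 => [|i' ni]; last by rewrite mxE (negPf ni) mul0r.
rewrite mxE eqxx addr0 mulrC eq_sym; case: eqP => [->|_]; last by rewrite !mul0r.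
by rewrite subU mpolyX0 meval1 mulr1.
Qed.

Lemma homog2_has_matrix f : f \is 2.-homog -> has_matrix f.
Proof.
move=> /dhomogP fhom; rewrite [f]mpolyE.
elim: (msupp f) {fhom}(fhom : {in msupp f, forall m, mdeg m = 2}) => [|m ms IH] hm.
  rewrite big_nil; exists 0; split=> v => [|i].
    by rewrite meval0 big1 // => i _; rewrite big1 // => j _; rewrite mxE mul0r.
  by rewrite mderiv0 meval0 big1 // => j _; rewrite !mxE addr0 mul0r.
have [|q [fq dq]] := IH; first by move=> m' m's; apply: hm; rewrite inE m's orbT.
have [i [j ->]] : exists i j, m = (U_(i) + U_(j))%MM.
  have m2 : mdeg m = 2 by apply: hm; rewrite mem_head.
  have [i mi] : exists i, m i != 0%N.
    apply/existsP; rewrite -negb_forall; apply/negP => /forallP m0.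
    by move: m2; rewrite mdegE big1 // => i _; apply/eqP/m0.
  have lem : (U_(i) <= m)%MM by rewrite lep1mP.
  have /mdeg1P[j /eqP mj] : mdeg (m - U_(i))%MM == 1%N.
    by move: m2; rewrite -(submK lem) mdegD mdeg1 addn1 submK // => -[->].
  by exists i, j; rewrite addmC -mj submK.
rewrite big_cons mpolyXD; have [q' [fq' dq']] := has_matrixX i j.
set k := f@_ _; exists (k *: q' + q); split=> v => [|l].
  rewrite mevalD mevalZ fq fq' mulr_sumr -big_split; apply: eq_bigr => i' _ /=.
  rewrite mulr_sumr -big_split; apply: eq_bigr => j' _ /=.
  rewrite !mxE. by ring.
rewrite mderivD mderivZ mevalD mevalZ dq dq' mulr_sumr -big_split.
by apply: eq_bigr => j' _ /=; rewrite !mxE; ring.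
Qed.

Definition polar (f : {mpoly K[3]}) (v w : 'rV[K]_3) : K :=
  \sum_(i < 3) f^`M(i).@[v ord0] * w ord0 i.

(** The Hessian matrix [q + q^T] works; the factor 2 is Euler's identity. *)
Lemma homog2_matrix f : f \is 2.-homog -> exists M : 'M[K]_3,
  [/\ M^T = M, forall v w, polar f v w = bform M v w
    & forall v, bform M v v = 2%:R * f.@[v ord0]].
Proof.
move=> /homog2_has_matrix[q [fq dq]]; exists (q + q^T).
have pol v w : polar f v w = bform (q + q^T) v w.
  rewrite /bform mxE; apply: eq_bigr => i _; rewrite dq !mxE; congr (_ * _).
  by apply: eq_bigr => j _; rewrite !mxE; ring.
split=> [|//|v]; first by rewrite linearD /= trmxK addrC.
rewrite -pol fq /polar mulr_natl mulr2n.
under eq_bigr do rewrite dq mulr_suml.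
under eq_bigr => i _ do (under eq_bigr => j _ do rewrite !mulrDl).
under eq_bigr do rewrite big_split /=.
rewrite big_split /= [X in _ + X]exchange_big /=; congr (_ + _).
  by do 2![apply: eq_bigr => ? _]; ring.
by do 2![apply: eq_bigr => ? _]; ring.
Qed.

End Quadric.

(** * Smoothness as nondegeneracy, tangency as a vanishing Gram determinant *)

Section Nondegenerate.
Variable K : fieldType.
Implicit Types (u v w : 'rV[K]_3).

Definition nondegenerate_mx (M : 'M[K]_3) := forall v, v *m M = 0 -> v = 0.

Lemma free3_span u v w x : free3 u v w ->
  exists r s t : K, x = r *: u + s *: v + t *: w.
Proof.
move=> uvw; pose E : 'M_(1 + (1 + 1), 3) := col_mx u (col_mx v w).
have mulE (y : 'rV_(1 + (1 + 1))) : exists r s t : K,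
    y *m E = r *: u + s *: v + t *: w /\ (r = 0 -> s = 0 -> t = 0 -> y = 0).
  exists (lsubmx y 0 0), (lsubmx (rsubmx y) 0 0), (rsubmx (rsubmx y) 0 0).
  have -> : y = row_mx (lsubmx y 0 0)%:M
      (row_mx (lsubmx (rsubmx y) 0 0)%:M (rsubmx (rsubmx y) 0 0)%:M).
    by rewrite -!mx11_scalar !hsubmxK.
  rewrite /E !mul_row_col !mul_scalar_mx addrA.
  rewrite !(row_mxKl, row_mxKr) !mxE !eqxx !mulr1n; split=> // -> -> ->.
  by rewrite !raddf0 !row_mx0.
have Efree : row_free E.
  rewrite -kermx_eq0; apply/rowV0P => y /sub_kermxP.
  by have [r [s [t [-> y0]]]] := mulE y => /uvw[]; exact: y0.
have : (x <= E)%MS by rewrite submx_full // /row_full (eqP Efree).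
by case/submxP => y ->; have [r [s [t [-> _]]]] := mulE y; exists r, s, t.
Qed.

Lemma nondegenerate_free3 M u v w x : nondegenerate_mx M -> free3 u v w ->
  bform M x u = 0 -> bform M x v = 0 -> bform M x w = 0 -> x = 0.
Proof.
move=> Mnd uvw xu xv xw; apply: Mnd; apply/rowP => j; rewrite [RHS]mxE.
transitivity (bform M x (delta_mx 0 j)).
  by rewrite /bform trmx_delta -colE [RHS]mxE.
have [r [s [t ->]]] := free3_span (delta_mx 0 j) uvw.
by rewrite !bformE xu xv xw !mulr0 !addr0.
Qed.

(** A nonzero kernel vector of [M] spans a singular point: the partial derivatives are values of the
    polar form at basis vectors, and [2 f] is its diagonal. *)
Lemma smooth_conic_nondegenerate f M : (2%:R : K) != 0 -> smooth_conic f ->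
    (forall v w, polar f v w = bform M v w) ->
    (forall v, bform M v v = 2%:R * f.@[v ord0]) ->
  nondegenerate_mx M.
Proof.
move=> two0 [_ fsm] fM fQ v vM0; apply/eqP/negP => /negP v0.
have dv : \dim <[v]> == 1%N by rewrite dim_vline v0.
have lin (k : K) w : bform M (k *: v) w = 0.
  by rewrite bformZl /bform vM0 mul0mx mxE mulr0.
apply: (fsm (exist _ <[v]>%VS dv)); split=> [u|i u] /vlineP[k ->].
  by apply: (mulfI two0); rewrite -fQ lin mulr0.
transitivity (polar f (k *: v) (delta_mx 0 i)); last by rewrite fM lin.
rewrite /polar (bigD1 i) //= big1 => [|j nji].
  by rewrite mxE !eqxx mulr1 addr0.
by rewrite mxE (negPf nji) andbF mulr0.
Qed.

(** A point of tangency is spanned by a nonzero vector of [l] orthogonal to [u] and [v], that is, by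
    a vector in the radical of the form restricted to [l]. *)
Lemma tangent_gram f M (l : line K) u v : (2%:R : K) != 0 -> M^T = M ->
    (forall v w, polar f v w = bform M v w) ->
    (forall v, bform M v v = 2%:R * f.@[v ord0]) ->
    free2 u v -> val l = (<[u]> + <[v]>)%VS ->
  tangent f l <-> gram M u v = 0.
Proof.
move=> two0 MT fM fQ uv lE.
have ul : u \in val l by rewrite lE (subvP (addvSl _ _)) ?memv_line.
have vl : v \in val l by rewrite lE (subvP (addvSr _ _)) ?memv_line.
have uvl r s : r *: u + s *: v \in val l by rewrite rpredD ?rpredZ.
split=> [[[p dp] [_ /= /subvP pl tl]]|g0].
  have : vpick p != 0 by rewrite vpick0 -dimv_eq0 (eqP dp).
  have rp := memv_pick p; have := pl _ rp; rewrite lE.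
  case/memv_addP => _ /vlineP[r ->] [_ /vlineP[s ->] defx]; rewrite defx in rp *.
  have eu := tl _ u rp ul; have ev := tl _ v rp vl.
  rewrite [LHS](fM _ _) !bformE (bformC v u MT) in eu.
  rewrite [LHS](fM _ _) !bformE in ev.
  (* Cramer's rule for the system [eu], [ev] in the unknowns [r], [s]. *)
  have gr : gram M u v * r = 0.
    transitivity (bform M v v * (r * bform M u u + s * bform M u v)
       - bform M u v * (r * bform M u v + s * bform M v v)).
      by rewrite /gram; ring.
    by rewrite eu ev !mulr0 subrr.
  have gs : gram M u v * s = 0.
    transitivity (bform M u u * (r * bform M u v + s * bform M v v)
       - bform M u v * (r * bform M u u + s * bform M u v)).
      by rewrite /gram; ring.
    by rewrite eu ev !mulr0 subrr.
  apply: contra_neqP => /eqP g0; move/eqP: gr; move/eqP: gs.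
  rewrite !mulf_eq0 (negPf g0) /= => /eqP-> /eqP->.
  by rewrite !scale0r addr0.
have tang x : x \in val l -> x != 0 -> bform M x u = 0 -> bform M x v = 0 ->
    tangent f l.
  move=> lx x0 xu xv.
  have dx : \dim <[x]> == 1%N by rewrite dim_vline x0.
  have xl y : y \in val l -> bform M x y = 0.
    rewrite lE => /memv_addP[_ /vlineP[r' ->] [_ /vlineP[s' ->] ->]].
    by rewrite !bformE xu xv !mulr0 addr0.
  exists (exist _ <[x]>%VS dx); split=> [y /vlineP[k ->]||y z /vlineP[k ->] zl].
  - by apply: (mulfI two0); rewrite -fQ !bformE xl // !mulr0.
  - by rewrite /on_line /= -memvE.
  - by rewrite [LHS](fM _ _) bformZl xl ?mulr0.
(* The radical contains [u] if [u] is isotropic; otherwise it contains the second vector below, a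
   combination of [u] and [v] orthogonal to [u]. *)
have [uu0|uu0] := eqVneq (bform M u u) 0.
  have uv0 : bform M u v = 0.
    by move/eqP: g0; rewrite /gram uu0 mul0r sub0r oppr_eq0 sqrf_eq0 => /eqP.
  apply: (tang u) => //.
  apply/eqP => u0; have [] := uv 1 0; first by rewrite u0 scaler0 scale0r addr0.
  by move/eqP; rewrite oner_eq0.
apply: (tang (bform M u v *: u + (- bform M u u) *: v)) => //.
- by apply: contra_neq uu0 => /uv[_ /eqP]; rewrite oppr_eq0 => /eqP.
- by rewrite !bformE (bformC v u MT); ring.
- by rewrite !bformE -[RHS]oppr0 -g0 /gram; ring.
Qed.

End Nondegenerate.

(** * Parametrization of a conic *)

Definition conic_pt (K : fieldType) (e0 e1 e2 : 'rV[K]_3) (t : K) :=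
  e0 + t *: e1 + t ^+ 2 *: e2.

Section Parametrization.
Variables (K : closedFieldType) (M : 'M[K]_3).
Hypotheses (two0 : (2%:R : K) != 0) (MT : M^T = M) (Mnd : nondegenerate_mx M).
Implicit Types (u v w h e : 'rV[K]_3) (s t : K).

(* A nondegenerate form in three variables has no totally isotropic plane. *)
Lemma isotropic_pair u w : free2 u w -> bform M u u = 0 -> bform M w w = 0 ->
  bform M u w != 0.
Proof.
move=> uw Quu Qww; apply/eqP => Quw.
pose N : 'M_(1 + 1, 3) := col_mx u w.
have Nfree : row_free N.
  rewrite -kermx_eq0; apply/rowV0P => y /sub_kermxP.
  rewrite -[y]hsubmxK [lsubmx y]mx11_scalar [rsubmx y]mx11_scalar.
  rewrite mul_row_col !mul_scalar_mx => /uw[-> ->].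
  by rewrite !raddf0 row_mx0.
have Mfree : row_free M.
  by rewrite -kermx_eq0; apply/rowV0P => y /sub_kermxP/Mnd.
have mx1 (A : 'M[K]_1) : A 0 0 = 0 -> A = 0.
  by move=> A0; rewrite [A]mx11_scalar A0 raddf0.
have : (N *m M) *m N^T = 0.
  rewrite mul_col_mx tr_col_mx mul_col_row (mx1 _ Quu) (mx1 _ Quw) (mx1 _ Qww).
  by rewrite [w *m M *m u^T]mx1 ?block_mx_const //; rewrite -[LHS]bformC.
move/mulmx0_rank_max; rewrite mxrankMfree // mxrank_tr.
by rewrite (eqP Nfree).
Qed.

Lemma orthogonal_complement u w :
  exists h, [/\ h != 0, bform M h u = 0 & bform M h w = 0].
Proof.
pose A := M *m row_mx u^T w^T.
have : kermx A != 0.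
  rewrite kermx_eq0 /row_free neq_ltn (leq_ltn_trans (rank_leq_col A)) //.
case/rowV0Pn => h /sub_kermxP; rewrite mulmxA mul_mx_row => hA h0.
have hAj j : row_mx (h *m M *m u^T) (h *m M *m w^T) 0 j = 0 by rewrite hA mxE.
exists h; split=> //.
  by have := hAj (lshift 1 0); rewrite row_mxEl.
by have := hAj (rshift 1 0); rewrite row_mxEr.
Qed.

(** A vector orthogonal to both [u] and [w] is not isotropic, by nondegeneracy; a square root
    rescales it to bring the form to a multiple of [r t - s ^ 2]. *)
Lemma isotropic_basis u w :
    free2 u w -> bform M u u = 0 -> bform M w w = 0 ->
  exists h, free3 u h w /\ forall r s t,
    bform M (r *: u + s *: h + t *: w) (r *: u + s *: h + t *: w) =
    2%:R * bform M u w * (r * t - s ^+ 2).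
Proof.
move=> uw Quu Qww; have Quw := isotropic_pair uw Quu Qww.
have [h [h0 hu hw]] := orthogonal_complement u w.
have uhw k : k != 0 -> free3 u (k *: h) w.
  move=> k0 r s t E.
  have t0 : t = 0.
    apply: (mulIf Quw); transitivity (bform M u (r *: u + s *: (k *: h) + t *: w)).
      by rewrite !bformE (bformC u h MT) hu Quu; ring.
    by rewrite E /bform trmx0 mulmx0 mxE mul0r.
  have r0 : r = 0.
    apply: (mulIf Quw); transitivity (bform M (r *: u + s *: (k *: h) + t *: w) w).
      by rewrite !bformE hw Qww; ring.
    by rewrite E /bform !mul0mx mxE mul0r.
  split=> //; move/eqP: E; rewrite t0 r0 !scale0r add0r addr0 !scaler_eq0.
  by rewrite (negPf k0) (negPf h0) !orbF => /eqP.
have Qhh : bform M h h != 0.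
  apply/eqP => Qhh; case/eqP: h0.
  apply: (@nondegenerate_free3 _ M u h w) => //.
  by have := uhw 1 (oner_neq0 _); rewrite scale1r.
have [k] := @solve_monicpoly K 2
  (fun i => if i is 0%N then - (2%:R * bform M u w) / bform M h h else 0) isT.
rewrite !big_ord_recl big_ord0 mul0r !addr0 mulr1 => kE.
have k0 : k != 0.
  apply: contraTneq isT => k0; move/eqP: kE; rewrite k0 expr0n /= eq_sym.
  by rewrite mulf_eq0 invr_eq0 oppr_eq0 mulf_eq0 (negPf two0) (negPf Quw) (negPf Qhh).
exists (k *: h); split; first exact: uhw.
move=> r s t; rewrite !bformE (bformC u h MT) (bformC w h MT) (bformC w u MT).
rewrite hu hw Quu Qww.
have kQ : k ^+ 2 * bform M h h = - (2%:R * bform M u w) by rewrite kE divfK.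
transitivity (2%:R * bform M u w * (r * t) + s ^+ 2 * (k ^+ 2 * bform M h h)).
  by ring.
by rewrite kQ; ring.
Qed.

Lemma nonroot_all (I : finType) (P : I -> {poly K}) : (forall i, P i != 0) ->
  exists t, forall i, (P i).[t] != 0.
Proof.
move=> P0; have /closed_nonrootP[t tP] : \prod_i P i != 0 by apply/prodf_neq0.
exists t => i; apply: contraNneq tP => Pit.
by rewrite /root horner_prod; apply/prodf_eq0; exists i => //; apply/eqP.
Qed.

(* [tau] is the parameter of a point avoiding all the [v i]; it is sent to
   infinity. *)
Lemma conic_parametrization n (v : 'I_n.+2 -> 'rV[K]_3) :
    (forall i, bform M (v i) (v i) = 0) -> (forall i j, i != j -> free2 (v i) (v j)) ->
  exists e0 e1 e2 (x : 'I_n.+2 -> K),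
  [/\ free3 e0 e1 e2,
      forall t, bform M (conic_pt e0 e1 e2 t) (conic_pt e0 e1 e2 t) = 0
    & forall i, exists2 k, k != 0 & v i = k *: conic_pt e0 e1 e2 (x i)].
Proof.
move=> Qv vfree; pose u := v ord0; pose w := v ord_max.
have uw : free2 u w by apply: vfree.
have Quw := isotropic_pair uw (Qv _) (Qv _).
have [h [uhw Qb]] := isotropic_basis uw (Qv _) (Qv _).
(* Coordinates [r ^ 2], [r s], [s ^ 2] parametrize the zeros of the normal form; [(0, 1)] gives
   [w]. *)
pose pt r s := r ^+ 2 *: u + (r * s) *: h + s ^+ 2 *: w.
have vE i : exists rs : K * K, (rs.1 != 0 \/ rs.2 != 0) /\
    exists2 k, k != 0 & v i = k *: pt rs.1 rs.2.
  have v0 : v i != 0.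
    apply/eqP => vi0; pose j := if i == ord0 then ord_max else ord0 : 'I_n.+2.
    have ij : i != j by rewrite /j; have [->|] := eqVneq i ord0.
    have [] := vfree i j ij 1 0; first by rewrite vi0 scaler0 scale0r addr0.
    by move/eqP; rewrite oner_eq0.
  have [r [s [t E]]] := free3_span (v i) uhw.
  have : r * t - s ^+ 2 = 0.
    apply: (mulfI (_ : 2%:R * bform M u w != 0)); first by rewrite mulf_neq0.
    by rewrite -Qb -E Qv mulr0.
  move/subr0_eq => rt; have [r0|r0] := eqVneq r 0; last first.
    exists (r, s); split; first by left.
    exists r^-1; rewrite ?invr_eq0 // /pt E /= -rt.
    by apply/rowP => j; rewrite !mxE; field.
  have s0 : s = 0 by apply/eqP; rewrite -sqrf_eq0 -rt r0 mul0r.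
  have Ew : v i = t *: w by rewrite E r0 s0 !scale0r !add0r.
  exists (0, 1); split; first by right; rewrite oner_neq0.
  exists t; first by apply: contra_neq v0 => t0; rewrite Ew t0 scale0r.
  by rewrite /pt /= expr0n /= mul0r !scale0r !add0r expr1n scale1r.
have [rs {}vE] := choice vE.
have [|tau tauP] := @nonroot_all _ (fun i => (rs i).2%:P - (rs i).1%:P * 'X).
  move=> i; apply/eqP => /(congr1 (fun p : {poly K} => (p`_0, p`_1))).
  rewrite !coefB !coefC !coefCM !coefX !mulr0 mulr1 subr0 sub0r => -[s0 /eqP].
  by rewrite oppr_eq0 => r0; case: (vE i) => -[]; rewrite ?s0 ?r0 ?eqxx.
(* These are the coefficients of [1], [t], [t ^ 2] in [pt t (1 + tau * t)]; the next line inverts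
   [(r : s) = (t : 1 + tau * t)]. *)
exists w, (h + (2%:R * tau) *: w), (u + tau *: h + tau ^+ 2 *: w).
exists (fun i => (rs i).1 / ((rs i).2 - (rs i).1 * tau)).
have ptE t : conic_pt w (h + (2%:R * tau) *: w) (u + tau *: h + tau ^+ 2 *: w) t =
    pt t (1 + tau * t).
  apply/rowP => j; rewrite !mxE; ring.
split=> [r s t E|t|i].
- have [|t0 s0 r0] := uhw t (s + t * tau) (r + s * (2%:R * tau) + t * tau ^+ 2).
    by rewrite -E; apply/rowP => j; rewrite !mxE; ring.
  move: s0 r0; rewrite t0 !mul0r !addr0 => s0; rewrite s0 mul0r addr0.
  by [].
- by rewrite ptE Qb; ring.
- have [_ [k k0 ->]] := vE i.
  have := tauP i; rewrite !hornerE => d0.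
  exists (k * ((rs i).2 - (rs i).1 * tau) ^+ 2).
    by rewrite mulf_neq0 ?expf_neq0.
  rewrite ptE -scalerA; congr (_ *: _).
  by apply/rowP => j; rewrite !mxE; field.
Qed.

Lemma conic_pt_free3 e0 e1 e2 r s t : free3 e0 e1 e2 -> r != s -> r != t -> s != t ->
  free3 (conic_pt e0 e1 e2 r) (conic_pt e0 e1 e2 s) (conic_pt e0 e1 e2 t).
Proof.
move=> efree rs rt st a b c E.
have [|E0 E1 E2] := efree (a + b + c) (a * r + b * s + c * t)
  (a * r ^+ 2 + b * s ^+ 2 + c * t ^+ 2).
  by rewrite -[RHS]E; apply/rowP => j; rewrite !mxE; ring.
(* Vandermonde: weighting the three equations by the coefficients of [(T - q) (T - k)] isolates
   [x]. *)
have van (x y z p q k : K) : p != q -> p != k -> x + y + z = 0 ->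
    x * p + y * q + z * k = 0 -> x * p ^+ 2 + y * q ^+ 2 + z * k ^+ 2 = 0 -> x = 0.
  move=> pq pk F0 F1 F2; apply: (mulIf (_ : (p - q) * (p - k) != 0)).
    by rewrite mulf_neq0 ?subr_eq0.
  transitivity ((x * p ^+ 2 + y * q ^+ 2 + z * k ^+ 2)
    - (q + k) * (x * p + y * q + z * k) + q * k * (x + y + z)); first by ring.
  by rewrite F0 F1 F2; ring.
split; first exact: (van a b c r s t).
  apply: (van b a c s r t) => //; first by rewrite eq_sym.
  - by rewrite -E0; ring.
  - by rewrite -E1; ring.
  - by rewrite -E2; ring.
apply: (van c a b t r s); try by rewrite eq_sym.
- by rewrite -E0; ring.
- by rewrite -E1; ring.
- by rewrite -E2; ring.
Qed.

(** The second point minus the first is [t - s] times [e1 + (s + t) e2], whence the factor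
    [(t - s) ^ 2]. If [bqA] vanished at [s] despite two distinct roots, the whole quadratic would
    vanish there, making every chord through that point tangent. *)
Lemma chord_gram e0 e1 e2 : free3 e0 e1 e2 -> exists a b c d l m : K,
  (forall s t, gram M (conic_pt e0 e1 e2 s) (conic_pt e0 e1 e2 t) =
     (t - s) ^+ 2 * bq a b c d l m idfun s t) /\
  (forall s y z, y != z -> bq a b c d l m idfun s y = 0 ->
     bq a b c d l m idfun s z = 0 -> bqA a b c idfun s != 0).
Proof.
move=> efree; pose q e e' := bform M e e'.
exists (q e2 e2 * q e1 e1 - q e1 e2 ^+ 2),
       (2%:R * (q e0 e1 * q e2 e2 - q e0 e2 * q e1 e2)),
       (q e0 e0 * q e2 e2 - q e0 e2 ^+ 2),
       (2%:R * (q e0 e1 * q e1 e2 - q e0 e2 * q e1 e1)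
        + 2%:R * (q e0 e0 * q e2 e2 - q e0 e2 ^+ 2)),
       (2%:R * (q e0 e0 * q e1 e2 - q e0 e1 * q e0 e2)),
       (q e0 e0 * q e1 e1 - q e0 e1 ^+ 2).
have C10 : bform M e1 e0 = bform M e0 e1 by apply: bformC.
have C20 : bform M e2 e0 = bform M e0 e2 by apply: bformC.
have C21 : bform M e2 e1 = bform M e1 e2 by apply: bformC.
split=> [s t|s y z yz sy sz].
  rewrite /gram /conic_pt /bq /bqA /bqB /bqC /q !bformE C10 C20 C21 /=.
  by ring.
apply/eqP => A0; move: sy sz; rewrite /bq A0 !mul0r !add0r => sy sz.
have B0 : bqB (2%:R * (q e0 e1 * q e2 e2 - q e0 e2 * q e1 e2))
  (2%:R * (q e0 e1 * q e1 e2 - q e0 e2 * q e1 e1)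
        + 2%:R * (q e0 e0 * q e2 e2 - q e0 e2 ^+ 2))
  (2%:R * (q e0 e0 * q e1 e2 - q e0 e1 * q e0 e2)) idfun s = 0.
  apply: (mulIf (_ : y - z != 0)); first by rewrite subr_eq0.
  have /addIr Byz := etrans sy (esym sz).
  by rewrite mul0r mulrBr Byz subrr.
have C0 := sy; rewrite B0 mul0r add0r in C0.
pose u := conic_pt e0 e1 e2 s; pose f := e1 + s *: e2.
have fr : free3 u f e2.
  move=> r1 r2 r3 E; have [|Z0 Z1 Z2] := efree r1 (r1 * s + r2) (r1 * s ^+ 2 + r2 * s + r3).
    by rewrite -[RHS]E; apply/rowP => j; rewrite !mxE; ring.
  move: Z1 Z2; rewrite Z0 !mul0r !add0r => Z1; rewrite Z1 mul0r add0r.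
  by [].
(* Half of [B], together with [A] and [C], gives the coefficients of [gram M u (f + t *: e2)] in
   [t]. *)
have gA : q u u * q e2 e2 - q u e2 ^+ 2 = 0.
  rewrite -[RHS]A0 /bqA /u /conic_pt /q !bformE C10 C20 C21 /=; ring.
have gB : q u u * q f e2 - q u f * q u e2 = 0.
  apply: (mulfI two0); rewrite mulr0 -[RHS]B0.
  rewrite /bqB /u /f /conic_pt /q !bformE C10 C20 C21 /=; ring.
have gC : q u u * q f f - q u f ^+ 2 = 0.
  rewrite -[RHS]C0 /bqC /u /f /conic_pt /q !bformE C10 C20 C21 /=; ring.
(* Either [u] or the component of [e2] orthogonal to [u] is now orthogonal to the whole basis,
   against nondegeneracy. *)
have [uu0|uu0] := eqVneq (q u u) 0.
  move: gA gC; rewrite uu0 !mul0r !sub0r => /eqP; rewrite oppr_eq0 sqrf_eq0 => /eqP ue2.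
  move=> /eqP; rewrite oppr_eq0 sqrf_eq0 => /eqP uf.
  have u0 := nondegenerate_free3 Mnd fr uu0 uf ue2.
  have [] := fr 1 0 0; first by rewrite u0 !scale0r scaler0 !addr0.
  by move/eqP; rewrite oner_eq0.
have r0 : q u u *: e2 - q u e2 *: u = 0.
  apply: (nondegenerate_free3 Mnd fr); rewrite -?scaleNr !bformDl !bformZl /q.
  - by rewrite (bformC e2 u MT); ring.
  - by rewrite (bformC e2 f MT) -[RHS]gB /q; ring.
  - by rewrite -[RHS]gA /q; ring.
have [] := fr (- q u e2) 0 (q u u).
  by rewrite -r0 scale0r addr0 scaleNr addrC.
by move=> _ _ /eqP; rewrite (negPf uu0).
Qed.

End Parametrization.

(** * Polygons inscribed in a conic *)

Section Incidence.
Variable K : fieldType.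
Implicit Types (u v w : 'rV[K]_3) (p : Defs.point K) (l : line K).

Lemma point_vpick p : vpick (val p) != 0 /\ val p = <[vpick (val p)]>%VS.
Proof.
case: p => U dU /=; have U0 : vpick U != 0 by rewrite vpick0 -dimv_eq0 (eqP dU).
split=> //; apply/esym/eqP; rewrite eqEdim -memvE memv_pick /=.
by rewrite dim_vline U0 (eqP dU).
Qed.

Lemma free2_vline u w : u != 0 -> w != 0 -> <[u]>%VS <> <[w]>%VS -> free2 u w.
Proof.
move=> u0 w0 uw s t E; have t0 : t = 0.
  apply/eqP/negP => /negP t0; apply: uw; apply/esym/eqP.
  rewrite eqEdim !dim_vline u0 w0 andbT -memvE; apply/vlineP; exists (- (t^-1 * s)).
  rewrite scaleNr -scalerA; apply/eqP; rewrite -addr_eq0 addrC -[w](scalerK t0).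
  by rewrite -scalerDr E scaler0.
move: E; rewrite t0 scale0r addr0 => /eqP; rewrite scaler_eq0 (negPf u0) orbF.
by move/eqP.
Qed.

Lemma free2_neq0 u w : free2 u w -> u != 0.
Proof.
move=> uw; apply/eqP => u0; have [] := uw 1 0.
  by rewrite u0 scaler0 scale0r addr0.
by move/eqP; rewrite oner_eq0.
Qed.

Lemma free2C u w : free2 u w -> free2 w u.
Proof. by move=> uw s t; rewrite addrC => /uw[]. Qed.

Lemma dim_free2 u w : free2 u w -> \dim (<[u]> + <[w]>)%VS = 2.
Proof.
move=> uw; rewrite dimv_disjoint_sum.
  by rewrite !dim_vline (free2_neq0 uw) (free2_neq0 (free2C uw)).
apply/eqP; rewrite -subv0; apply/subvP => x; rewrite memv_cap.
case/andP => /vlineP[s ->] /vlineP[t E].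
have [|-> _] := uw s (- t); first by rewrite E scaleNr subrr.
by rewrite scale0r mem0v.
Qed.

Lemma line_span l u w : free2 u w -> u \in val l -> w \in val l ->
  val l = (<[u]> + <[w]>)%VS.
Proof.
move=> uw ul wl; apply/esym/eqP; rewrite eqEdim dim_free2 //.
by rewrite subv_add -!memvE ul wl (eqP (valP l)).
Qed.

Lemma line_not_free3 l u v w : free3 u v w ->
  u \in val l -> v \in val l -> w \in val l -> False.
Proof.
move=> uvw ul vl wl; have uv : free2 u v.
  by move=> s t E; have [|-> ->] := uvw s t 0; rewrite ?scale0r ?addr0.
move: wl; rewrite (line_span uv ul vl) => /memv_addP[_ /vlineP[s ->] [_ /vlineP[t ->] E]].
have [|_ _ /eqP] := uvw s t (-1); first by rewrite E scaleN1r subrr.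
by rewrite oppr_eq0 oner_eq0.
Qed.

Lemma gramZ (M : 'M[K]_3) s t u w :
  gram M (s *: u) (t *: w) = (s * t) ^+ 2 * gram M u w.
Proof. by rewrite /gram !bformE; ring. Qed.

Lemma conic_pt_free2 e0 e1 e2 (s t : K) : free3 e0 e1 e2 -> s != t ->
  free2 (conic_pt e0 e1 e2 s) (conic_pt e0 e1 e2 t).
Proof.
move=> efree st a b E; have [|E0 E1 _] := efree (a + b) (a * s + b * t)
  (a * s ^+ 2 + b * t ^+ 2).
  by rewrite -[RHS]E; apply/rowP => j; rewrite !mxE; ring.
have ba : b = - a by apply/eqP; rewrite -addr_eq0 addrC E0.
suff a0 : a = 0 by rewrite ba a0 oppr0.
apply: (mulIf (_ : s - t != 0)); first by rewrite subr_eq0.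
by rewrite mul0r -[RHS]E1 ba; ring.
Qed.

End Incidence.

Lemma modnD_neq n i k : (0 < k < n)%N -> (i < n)%N -> ((i + k) %% n)%N != i.
Proof.
move=> /andP[k0 kn] ltin; have := eqn_modDl i k 0 n.
by rewrite addn0 mod0n !(modn_small ltin) (modn_small kn) => ->; rewrite -lt0n.
Qed.

Lemma ordS_neq n (i : 'I_n.+2) : ordS i != i.
Proof. by rewrite -val_eqE /= -addn1 modnD_neq. Qed.

Lemma ordSS_neq n (i : 'I_n.+3) : ordS (ordS i) != i.
Proof. by rewrite -val_eqE /= -addn1 modnDml addn1 -addn2 modnD_neq. Qed.

Section Polygons.
Variable K : closedFieldType.

Lemma conic_ngon n (e0 e1 e2 : 'rV[K]_3) (y : 'I_n.+3 -> K) :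
    free3 e0 e1 e2 -> injective y ->
  exists (p : 'I_n.+3 -> Defs.point K) (l : 'I_n.+3 -> line K),
  [/\ forall i, val (p i) = <[conic_pt e0 e1 e2 (y i)]>%VS,
      forall i, val (l i) =
        (<[conic_pt e0 e1 e2 (y i)]> + <[conic_pt e0 e1 e2 (y (ordS i))]>)%VS
    & ngon n.+3 (range p, range l)].
Proof.
move=> efree yinj; pose phi := conic_pt e0 e1 e2.
have phi_free s t : s != t -> free2 (phi s) (phi t) by apply: conic_pt_free2.
have yS i : y i != y (ordS i) by rewrite (inj_eq yinj) eq_sym ordS_neq.
have phi0 i : phi (y i) != 0 by apply: free2_neq0 (phi_free _ _ (yS i)).
have dp i : \dim <[phi (y i)]> == 1%N by rewrite dim_vline phi0.
have dl i : \dim (<[phi (y i)]> + <[phi (y (ordS i))]>)%VS == 2.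
  by rewrite dim_free2 //; apply: phi_free.
pose p i : Defs.point K := exist (fun U : {vspace _} => \dim U == 1%N) _ (dp i).
pose l i : line K := exist (fun U : {vspace _} => \dim U == 2) _ (dl i).
have pl i : phi (y i) \in val (l i) by rewrite (subvP (addvSl _ _)) ?memv_line.
have pSl i : phi (y (ordS i)) \in val (l i).
  by rewrite (subvP (addvSr _ _)) ?memv_line.
exists p, l; split=> //; exists p, l; split=> //.
- move=> i j /(congr1 val) /= pij; apply/yinj/eqP/negP => /negP /phi_free phiij.
  have : phi (y i) \in <[phi (y j)]>%VS by rewrite -pij memv_line.
  case/vlineP => k E; have [|/eqP] := phiij 1 (- k).
    by rewrite scale1r scaleNr E subrr.
  by rewrite oner_eq0.
(* A side contains no third vertex. So if sides [i] and [j] coincide with [i != j], then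
   [j = i + 1], and the vertex [i + 2] lies on side [i], which is impossible for at least three
   vertices. *)
- have absurd i k : k != i -> k != ordS i -> phi (y k) \notin val (l i).
    move=> ki kS; apply/negP => phik.
    have fr : free3 (phi (y i)) (phi (y (ordS i))) (phi (y k)).
      by apply: conic_pt_free3; rewrite ?(inj_eq yinj) // eq_sym // ordS_neq.
    exact: line_not_free3 fr (pl i) (pSl i) phik.
  move=> i j lij; apply/eqP/negP => /negP ij.
  have [jS|jS] := eqVneq j (ordS i); last first.
    by have := absurd i j; rewrite eq_sym ij jS lij pl => /(_ isT isT).
  have := absurd i (ordS j); rewrite lij pSl jS ordSS_neq ordS_neq.
  by move/(_ isT isT).
- by move=> i; rewrite /on_line /= -!memvE; split; [exact: pl | exact: pSl].
Qed.

End Polygons.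

(** * Closure *)

Section Poncelet.
Variable K : closedFieldType.
Hypothesis char0 : [pchar K] =i pred0.

Let two0 : (2%:R : K) != 0.
Proof. by rewrite ((pcharf0P K).1 char0). Qed.

Lemma infinite_nonroots (h : {poly K}) : h != 0 -> infinite_set [set s | h.[s] != 0].
Proof.
move=> h0 /finite_seqP[r hr].
have /closed_nonrootP[s] : h * \prod_(t <- r) ('X - t%:P) != 0.
  by rewrite mulf_neq0 // monic_neq0 // monic_prod_XsubC.
rewrite rootM root_prod_XsubC => /norP[hs /negP]; apply.
by have : [set s | h.[s] != 0] s by []; rewrite hr.
Qed.

Lemma cyclic_nearby n (a b c d l m : K) (x : 'I_n.+3 -> K) : injective x ->
    (forall i, bq a b c d l m idfun (x i) (x (ordS i)) = 0) ->
    (forall s y z, y != z -> bq a b c d l m idfun s y = 0 ->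
       bq a b c d l m idfun s z = 0 -> bqA a b c idfun s != 0) ->
  exists2 h : {poly K}, h != 0 & forall s, h.[s] != 0 ->
    exists y : 'I_n.+3 -> K, [/\ y ord0 = s, injective y
      & forall i, bq a b c d l m idfun (y i) (y (ordS i)) = 0].
Proof.
move=> xinj Fx HA; pose N := n.+3.
pose xs k := x (inord (k %% N)).
have modN k : (k %% N < N)%N by rewrite ltn_mod.
have xsN k : xs (k + N)%N = xs k by rewrite /xs modnDr.
have xsD i j k : (i < N)%N -> (j < N)%N -> i != j -> xs (k + i)%N != xs (k + j)%N.
  move=> iN jN; apply: contra_neq => /xinj/(congr1 val) /=.
  rewrite !inordK // => /eqP; rewrite eqn_modDl !modn_small // => /eqP //.
have Fxs k : bq a b c d l m idfun (xs k) (xs k.+1) = 0.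
  rewrite -(Fx (inord (k %% N))); congr bq; congr x; apply: val_inj => /=.
  by rewrite !inordK // -[in RHS]addn1 modnDml addn1.
(* [k + n.+2] is the predecessor of [k] modulo [N]; together with the successor it supplies two
   distinct roots, hence [A0]. *)
have pred k : bq a b c d l m idfun (xs k) (xs (k + n.+2)%N) = 0.
  by rewrite bq_sym -[xs k]xsN [(k + N)%N]addnS Fxs.
have A0 k : bqA a b c idfun (xs k) != 0.
  apply: (HA _ (xs k.+1) (xs (k + n.+2)%N)) => //.
  by rewrite -addn1; apply: xsD.
have xs2 k : xs k != xs k.+2 by rewrite -[k in xs k]addn0 -addn2; apply: xsD.
have d0 : bq_dy a b c d l idfun (xs 0%N) (xs 1%N) != 0.
  have x1 : xs 1%N != xs n.+2 by apply: (xsD 1 n.+2 0).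
  rewrite (bq_dyE x1 (Fxs 0) (pred 0)) mulf_neq0 ?subr_eq0 //.
have [|||h h0 hS] := nearby_cycles char0 A0 Fxs xs2 d0 (n := N).
- by rewrite -[N]add0n xsN.
- by rewrite -add1n xsN.
- move=> i j /andP[ij jN]; apply: (xsD i j 0) => //; first exact: ltn_trans jN.
  by rewrite neq_ltn ij.
exists h => // s /hS[y [y0 yN Fy yD]]; exists (fun i => y i); split=> // [i j yij|i].
  apply: val_inj; case: (ltngtP i j) => // ij.
    by have := yD i j; rewrite ij ltn_ord yij eqxx => /(_ isT).
  by have := yD j i; rewrite ij ltn_ord yij eqxx => /(_ isT).
have <- : y i.+1 = y (ordS i).
  have := ltn_ord i; rewrite leq_eqVlt /= => /predU1P[->|iN].
    by rewrite modnn yN.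
  by rewrite modn_small.
exact: Fy.
Qed.

Theorem poncelet_closure n (C D : {mpoly K[3]}) :
    smooth_conic C -> smooth_conic D ->
    (exists P, [/\ ngon n.+3 P, inscribed D P & circumscribed C P]) ->
  infinite_set [set P | [/\ ngon n.+3 P, inscribed D P & circumscribed C P]].
Proof.
move=> Csm Dsm [_ [[p [l [pinj linj pl ->]]] Dp Cl]].
have [MC [CT Cpol CQ]] := homog2_matrix (proj2 (proj1 Csm)).
have [MD [DT Dpol DQ]] := homog2_matrix (proj2 (proj1 Dsm)).
have Cnd := smooth_conic_nondegenerate two0 Csm Cpol CQ.
have Dnd := smooth_conic_nondegenerate two0 Dsm Dpol DQ.
pose v i := vpick (val (p i)).
have v0 i : v i != 0 by case: (point_vpick (p i)).
have pv i : val (p i) = <[v i]>%VS by case: (point_vpick (p i)).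
have Qv i : bform MD (v i) (v i) = 0.
  rewrite DQ (Dp (p i)) ?mulr0 //; first by exists i.
  exact: memv_pick.
have vfree i j : i != j -> free2 (v i) (v j).
  move=> ij; apply: free2_vline => // vij; case/eqP: ij; apply: pinj.
  by apply: val_inj; rewrite !pv.
have [e0 [e1 [e2 [x [efree Qe vx]]]]] := conic_parametrization two0 DT Dnd Qv vfree.
have [a [b [c [d [k [m [Cgram HA]]]]]]] := chord_gram two0 CT Cnd efree.
have xinj : injective x.
  move=> i j xij; apply/eqP/negP => /negP /vfree ij.
  have [s s0 vi] := vx i; have [t t0 vj] := vx j.
  have [|/eqP] := ij t (- s); last by rewrite (negPf t0).
  by rewrite vi vj xij scaleNr !scalerA mulrC subrr.
have Fx i : bq a b c d k m idfun (x i) (x (ordS i)) = 0.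
  have iS : i != ordS i by rewrite eq_sym ordS_neq.
  have lE : val (l i) = (<[v i]> + <[v (ordS i)]>)%VS.
    have [pil pSl] := pl i.
    by apply: line_span; rewrite ?memvE -?pv //; apply: vfree.
  have /(tangent_gram two0 CT Cpol CQ (vfree _ _ iS) lE) : tangent C (l i).
    by apply: Cl; exists i.
  have [s s0 ->] := vx i; have [t t0 ->] := vx (ordS i).
  rewrite gramZ Cgram => /eqP; rewrite !mulf_eq0.
  rewrite (negPf s0) (negPf t0) subr_eq0 (inj_eq xinj) eq_sym (negPf iS).
  by move/eqP.
have [h h0 hS] := cyclic_nearby xinj Fx HA.
pose phi := conic_pt e0 e1 e2.
have near s : h.[s] != 0 -> exists P : polygon K,
    [/\ ngon n.+3 P, inscribed D P & circumscribed C P] /\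
    exists2 q, P.1 q & val q = <[phi s]>%VS.
  move=> /hS[y [y0 yinj Fy]].
  have [q [g [qE gE qg]]] := conic_ngon efree yinj.
  exists (range q, range g); split; last first.
    by exists (q ord0); [exists ord0 | rewrite qE y0].
  split=> // [_ [i _ <-] u|_ [i _ <-]].
    rewrite qE => /vlineP[t ->]; apply: (mulfI two0).
    by rewrite -DQ bformZl bformZr Qe !mulr0.
  have iS : y i != y (ordS i) by rewrite (inj_eq yinj) eq_sym ordS_neq.
  apply/(tangent_gram two0 CT Cpol CQ (conic_pt_free2 efree iS) (gE i)).
  by rewrite Cgram Fy mulr0.
(* Finitely many polygons have finitely many vertices, yet each of the infinitely many nonroots [s]
   of [h] yields a vertex [phi s], and [s] is determined by that point. *)
set S := [set P | _] => Sfin; apply: (infinite_nonroots h0).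
have Ufin : finite_set (\bigcup_(P in S) [set val q | q in P.1]).
  apply: bigcup_finite => // _ [[q [g [_ _ _ ->]]] _ _] /=.
  by apply: finite_image; apply: finite_image; apply: finite_finset.
apply: (@sub_finite_set _ _ ((fun s => <[phi s]>%VS) @^-1` _)) (finite_preimage _ Ufin).
  by move=> s /near[P [SP [q Pq qE]]]; exists P => //; exists q.
move=> s t _ _ st; apply/eqP/negP => /negP /(conic_pt_free2 efree) stfree.
have : phi s \in <[phi t]>%VS by rewrite -st memv_line.
case/vlineP => r E; have [|/eqP] := stfree 1 (- r).
  by rewrite scale1r scaleNr -/phi E subrr.
by rewrite oner_eq0.
Qed.

End Poncelet.

Theorem theorem4p1 (R : realType) (n : nat) (hn : (3 <= n)%N)
    (C D : {mpoly (complex R)[3]}) (hC : smooth_conic C) (hD : smooth_conic D)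
    (hCD : exists P,
       [/\ ngon n P, inscribed D P & circumscribed C P]) :
  infinite_set [set P |
    [/\ ngon n P, inscribed D P & circumscribed C P]].
Proof.
case: n hn hCD => [|[|[|n]]] // _.
exact: (poncelet_closure (@Num.Theory.pchar_num (complex R)) hC hD).
Qed.
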